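(* Let $(g_n)_{n\ge 1}$ and $(h_n)_{n\ge1}$ be sequences of complex numbers with all $g_n\neq 0$, and suppose that the formal power series $f(x)$ has the continued fraction expansion $$f(x)=1-\cfrac{h_1 x}{g_1+h_1 x-\cfrac{g_1 h_2 x}{g_2+h_2 x-\cfrac{g_2 h_3 x}{g_3+h_3 x-\cfrac{g_3 h_4 x}{g_4+h_4 x-\ddots}}}}\,.$$ Let $a,b,c,d$ be complex numbers with $ad-bc\neq 0$ and $c+d\neq 0$, and let $\beta(y)=\dfrac{ay+b}{cy+d}$. Then $$\beta\bigl(f(x)\bigr)=\frac{a+b}{c+d}-\cfrac{\dfrac{ad-bc}{c+d}h_1 x}{(c+d)g_1+d h_1 x-\cfrac{(c+d)g_1 h_2 x}{g_2+h_2 x-\cfrac{g_2 h_3 x}{g_3+h_3 x-\cfrac{g_3 h_4 x}{g_4+h_4 x-\ddots}}}}\,,$$ i.e. $\beta(f(x))$ has the continued fraction expansion $a_0+\cfrac{b_1}{a_1+\cfrac{b_2}{a_2+\ddots}}$ with $a_0=\frac{a+b}{c+d}$, $b_1=-\frac{ad-bc}{c+d}h_1x$, $a_1=(c+d)g_1+dh_1x$, $b_2=-(c+d)g_1h_2x$, $a_n=g_n+h_nx$ for $n\ge 2$, and $b_n=-g_{n-1}h_nx$ for $n\ge 3$.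
   Context: Convention on continued fractions: for polynomials $a_n$ ($n\ge 0$), $b_n$ ($n\ge 1$) in $x$, the convergents $P_n/Q_n$ of $a_0+\cfrac{b_1}{a_1+\cfrac{b_2}{a_2+\ddots}}$ are defined by $P_{-1}=1$, $Q_{-1}=0$, $P_0=a_0$, $Q_0=1$, $P_n=a_nP_{n-1}+b_nP_{n-2}$, $Q_n=a_nQ_{n-1}+b_nQ_{n-2}$ ($n\ge 1$). A formal power series $f(x)$ has this continued fraction expansion (written as an equality) if for every $n\ge 0$ the power series expansion at $x=0$ of $P_n(x)/Q_n(x)$ agrees with $f(x)$ up to and including the term in $x^n$, i.e. $P_n/Q_n\equiv f\pmod{x^{n+1}}$; in particular $f=\lim_{n\to\infty}P_n/Q_n$ as formal power series. In the expansion of $f$ above, the data are $a_0=1$, $b_1=-h_1x$, $a_n=g_n+h_nx$ ($n\ge 1$), $b_n=-g_{n-1}h_nx$ ($n\ge 2$). (The indexed $a_n,b_n$ are not to be confused with the constants $a,b$.) *)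

(* Defs.v *)
From HB Require Import structures.
From mathcomp Require Import all_boot all_order all_algebra.
From mathcomp Require Import boolp.

Set Implicit Arguments.
Unset Strict Implicit.
Unset Printing Implicit Defensive.

Import GRing.Theory.
Local Open Scope ring_scope.

(* The ring of formal power series R[[x]]. The record wrapper keeps it apart
   from the pointwise ring structure that function types may carry. *)
Record fps (R : Type) := Fps { fcoef : nat -> R }.
Arguments Fps {R} fcoef.
Arguments fcoef {R} f n : rename.

HB.instance Definition _ (R : Type) := gen_eqMixin (fps R).
HB.instance Definition _ (R : Type) := gen_choiceMixin (fps R).

Section FpsRing.
Variable R : comUnitRingType.
Implicit Types f g k : fps R.

Lemma fpsP f g : (forall n, fcoef f n = fcoef g n) <-> f = g.
Proof. by split=> [|-> //]; case: f g => [u] [v] /= /funext ->. Qed.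

Definition fps0 : fps R := Fps (fun _ => 0).
Definition fps_add f g := Fps (fun n => fcoef f n + fcoef g n).
Definition fps_opp f := Fps (fun n => - fcoef f n).

Fact fps_addA : associative fps_add.
Proof. by move=> f g k; apply/fpsP=> n /=; rewrite addrA. Qed.
Fact fps_addC : commutative fps_add.
Proof. by move=> f g; apply/fpsP=> n /=; rewrite addrC. Qed.
Fact fps_add0 : left_id fps0 fps_add.
Proof. by move=> f; apply/fpsP=> n /=; rewrite add0r. Qed.
Fact fps_addN : left_inverse fps0 fps_opp fps_add.
Proof. by move=> f; apply/fpsP=> n /=; rewrite addNr. Qed.

HB.instance Definition _ :=
  GRing.isZmodule.Build (fps R) fps_addA fps_addC fps_add0 fps_addN.

Definition fpsC (a : R) : fps R := Fps (fun n => if n is 0%N then a else 0).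
Definition fps_mul f g :=
  Fps (fun n => \sum_(i < n.+1) fcoef f i * fcoef g (n - i)%N).

Let trunc n f : {poly R} := \poly_(i < n.+1) fcoef f i.

Let coef_trunc n f i : (i <= n)%N -> (trunc n f)`_i = fcoef f i.
Proof. by move=> le_in; rewrite coef_poly ltnS le_in. Qed.

Let mul_trunc n f g i : (i <= n)%N ->
  (trunc n f * trunc n g)`_i = fcoef (fps_mul f g) i.
Proof.
move=> le_in; rewrite coefM; apply: eq_bigr => j _.
rewrite !coef_trunc //; first exact: leq_trans (leq_subr _ _) le_in.
exact: leq_trans (leq_ord j) le_in.
Qed.

Fact fps_mulC : commutative fps_mul.
Proof.
by move=> f g; apply/fpsP=> n; rewrite -!(@mul_trunc n) // mulrC.
Qed.

Fact fps_mulA : associative fps_mul.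
Proof.
move=> f g k; apply/fpsP=> n.
transitivity ((trunc n f * (trunc n g * trunc n k))`_n).
  rewrite coefM; apply: eq_bigr => i _.
  by rewrite mul_trunc ?leq_subr // coef_trunc // leq_ord.
rewrite mulrA coefM; apply: eq_bigr => i _.
by rewrite mul_trunc ?leq_ord // coef_trunc // leq_subr.
Qed.

Fact fps_mul1 : left_id (fpsC 1) fps_mul.
Proof.
move=> f; apply/fpsP=> n /=.
by rewrite big_ord_recl /= mul1r subn0 big1 ?addr0 // => i _; rewrite mul0r.
Qed.

Fact fps_mulDl : left_distributive fps_mul fps_add.
Proof.
move=> f g k; apply/fpsP=> n /=; rewrite -big_split.
by apply: eq_bigr => i _; rewrite mulrDl.
Qed.

Fact fps1_neq0 : fpsC 1 != 0.
Proof.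
by apply/eqP=> /fpsP/(_ 0%N) /eqP; rewrite /= (negbTE (oner_neq0 R)).
Qed.

HB.instance Definition _ := GRing.Zmodule_isComNzRing.Build (fps R)
  fps_mulA fps_mulC fps_mul1 fps_mulDl fps1_neq0.

Lemma fcoefD f g n : fcoef (f + g) n = fcoef f n + fcoef g n.
Proof. by []. Qed.

Lemma fcoefM f g n :
  fcoef (f * g) n = \sum_(i < n.+1) fcoef f i * fcoef g (n - i)%N.
Proof. by []. Qed.

Lemma fcoef0M f g : fcoef (f * g) 0 = fcoef f 0 * fcoef g 0.
Proof. by rewrite fcoefM big_ord1. Qed.

Definition fps_unit : {pred fps R} := fun f => fcoef f 0 \is a GRing.unit.

(* The first n coefficients of 1 / f. *)
Fixpoint fps_inv_prefix f n : seq R :=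
  if n is m.+1 then
    let s := fps_inv_prefix f m in
    rcons s ((fcoef f 0)^-1 *
             ((m == 0)%:R - \sum_(i < m) fcoef f i.+1 * s`_(m - i.+1)))
  else [::].

Definition fps_inv f : fps R :=
  if f \in fps_unit then Fps (fun n => (fps_inv_prefix f n.+1)`_n) else f.

Let size_prefix f n : size (fps_inv_prefix f n) = n.
Proof. by elim: n => //= n IHn; rewrite size_rcons IHn. Qed.

Let nth_prefix f n i : (i < n)%N ->
  (fps_inv_prefix f n)`_i = (fps_inv_prefix f i.+1)`_i.
Proof.
elim: n => // n IHn; rewrite ltnS leq_eqVlt => /predU1P[-> //|lt_in].
by rewrite [in LHS]/= nth_rcons size_prefix lt_in IHn.
Qed.

Fact fps_mulVx : {in fps_unit, left_inverse 1 fps_inv *%R}.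
Proof.
move=> f Uf; rewrite mulrC /fps_inv Uf; apply/fpsP=> n.
rewrite fcoefM big_ord_recl subn0 [fcoef (Fps _) n]/=.
rewrite nth_rcons size_prefix ltnn eqxx mulrA divrr // mul1r.
set s1 := \sum_(i < n) _; set s2 := \sum_(i < n) _.
suff -> : s1 = s2 by rewrite subrK; case: (n).
apply: eq_bigr => i _; rewrite nth_prefix //.
by rewrite -subn_gt0 subKn.
Qed.

Fact fps_unitPl f g : g * f = 1 -> fps_unit f.
Proof.
move=> /fpsP/(_ 0%N); rewrite fcoef0M => gf1.
by apply/unitrPr; exists (fcoef g 0); rewrite mulrC.
Qed.

Fact fps_invr_out : {in [predC fps_unit], fps_inv =1 id}.
Proof. by move=> f /negbTE Uf; rewrite /fps_inv Uf. Qed.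

HB.instance Definition _ := GRing.ComNzRing_hasMulInverse.Build (fps R)
  fps_mulVx fps_unitPl fps_invr_out.

Lemma fps_unitE f : (f \is a GRing.unit) = (fcoef f 0 \is a GRing.unit).
Proof. by []. Qed.

Definition fps_of_poly (p : {poly R}) : fps R := Fps (fun n => p`_n).

(* (a y + b) / (c y + d) in R[[x]]; the division is the genuine one as soon as
   the constant term of c y + d is invertible. *)
Definition fps_moebius (a b c d : R) (y : fps R) : fps R :=
  (fpsC a * y + fpsC b) / (fpsC c * y + fpsC d).

End FpsRing.

Section ContinuedFractions.
Variable R : fieldType.
Implicit Types (a b : nat -> {poly R}).

(* The solution of X_n = a_n X_{n-1} + b_n X_{n-2} (n >= 1) with X_{-1} = u
   and X_0 = v; a 0 and b 0 do not enter the recursion. *)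
Fixpoint cf_rec a b (u v : {poly R}) n : {poly R} :=
  if n is m.+1 then
    a n * cf_rec a b u v m
      + b n * (if m is k.+1 then cf_rec a b u v k else u)
  else v.

Definition cf_num a b n := cf_rec a b 1 (a 0) n.
Definition cf_den a b n := cf_rec a b 0 1 n.

(* The rational function p / q is regular at x = 0 with expansion e there;
   q may vanish at 0, as in x / x. *)
Definition has_expansion (p q : {poly R}) (e : fps R) :=
  q != 0 /\ fps_of_poly q * e = fps_of_poly p.

(* f = a_0 + b_1 / (a_1 + b_2 / (a_2 + ...)); b 0 is irrelevant. *)
Definition has_cf_expansion (f : fps R) a b :=
  forall n, exists2 e, has_expansion (cf_num a b n) (cf_den a b n) e &
    forall k, (k <= n)%N -> fcoef e k = fcoef f k.

End ContinuedFractions.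

(* Main.v *)
Require Import Defs.
From mathcomp Require Import all_boot all_order all_algebra.
From mathcomp Require Import reals complex.
From mathcomp Require Import ring.

Import GRing.Theory.
Local Open Scope ring_scope.

(** If [P_n / Q_n] are the convergents of [f], then [a P_n + b Q_n] and
    [c P_n + d Q_n] satisfy the same recurrence, and for [n >= 1] they are
    exactly the numerators and denominators of the claimed fraction (for
    [n = 0] they are [c + d] times those).  Hence the new convergents expand to
    [beta e_n], where [e_n] is the expansion of [P_n / Q_n], and
    [beta e - beta f = (a d - b c) (e - f) / ((c e + d) (c f + d))] transports
    the order of agreement with [f]. *)

Section PowerSeries.
Variable R : comUnitRingType.
Implicit Types (e f u v : fps R) (p q : {poly R}).

Lemma fps_of_polyD p q : fps_of_poly (p + q) = fps_of_poly p + fps_of_poly q.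
Proof. by apply/fpsP=> n; rewrite fcoefD /= coefD. Qed.

Lemma fps_of_polyM p q : fps_of_poly (p * q) = fps_of_poly p * fps_of_poly q.
Proof. by apply/fpsP=> n; rewrite fcoefM /= coefM. Qed.

Lemma fps_of_polyC (k : R) : fps_of_poly k%:P = fpsC k.
Proof. by apply/fpsP=> -[|n] /=; rewrite coefC. Qed.

Lemma fps_of_poly_eq0 p : fps_of_poly p = 0 -> p = 0.
Proof. by move=> /fpsP p0; apply/polyP=> i; rewrite coef0; exact: p0. Qed.

Lemma fcoefB f e n : fcoef (f - e) n = fcoef f n - fcoef e n.
Proof. by []. Qed.

Lemma fcoef0_affine (c d : R) f :
  fcoef (fpsC c * f + fpsC d) 0 = c * fcoef f 0 + d.
Proof. by rewrite fcoefD fcoef0M. Qed.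

(** The multiples of [x^(n+1)] form an ideal. *)
Lemma fcoefM_eq0 u v n : (forall k, (k <= n)%N -> fcoef u k = 0) ->
  forall k, (k <= n)%N -> fcoef (u * v) k = 0.
Proof.
move=> u0 k le_kn; rewrite fcoefM big1 // => i _.
by rewrite u0 ?mul0r // (leq_trans (leq_ord i)).
Qed.

Lemma fps_moebius_congr (a b c d : R) e f n :
    c * fcoef f 0 + d \is a GRing.unit ->
    (forall k, (k <= n)%N -> fcoef e k = fcoef f k) ->
  forall k, (k <= n)%N ->
    fcoef (fps_moebius a b c d e) k = fcoef (fps_moebius a b c d f) k.
Proof.
move=> U eq_ef k le_kn.
have Uf : fpsC c * f + fpsC d \is a GRing.unit by rewrite fps_unitE fcoef0_affine.
have Ue : fpsC c * e + fpsC d \is a GRing.unit.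
  by rewrite fps_unitE fcoef0_affine eq_ef.
apply/eqP; rewrite -subr_eq0 -fcoefB /fps_moebius; apply/eqP.
set De := fpsC c * e + fpsC d in Ue *; set Df := fpsC c * f + fpsC d in Uf *.
set Ne := fpsC a * e + _; set Nf := fpsC a * f + _.
have -> : Ne / De - Nf / Df =
    (e - f) * ((fpsC a * fpsC d - fpsC b * fpsC c) * (De^-1 * Df^-1)).
  (* Each fraction is expanded by the denominator of the other; once [De^-1 * Df^-1] is split off, a
     polynomial identity remains. *)
  rewrite -[Ne / De](mulrK Uf) -[Nf / Df](mulrK Ue).
  rewrite -!mulrA [De^-1 * (Df * _)]mulrCA [Df^-1 * (De * _)]mulrCA.
  rewrite [Df^-1 * De^-1]mulrC !mulrA -!mulrBl; congr (_ * _ * _).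
  by rewrite /Ne /Nf /De /Df; ring.
by apply: (fcoefM_eq0 _ _ n) le_kn => i le_in; rewrite fcoefB eq_ef // subrr.
Qed.

End PowerSeries.

Section Convergents.
Variable R : fieldType.
Implicit Types (e : fps R) (p q : {poly R}).

(** Serves the convergent of index 0, where a factor [c + d] must be removed. *)
Lemma has_expansion_scale (k : R) p q e : k != 0 -> has_expansion p q e ->
  has_expansion (k%:P * p) (k%:P * q) e.
Proof.
move=> k0 [q0 qe]; split; first by rewrite mulf_neq0 ?polyC_eq0.
by rewrite !fps_of_polyM -mulrA qe.
Qed.

Lemma has_expansion_moebius (a b c d : R) p q e :
    c * fcoef e 0 + d != 0 -> has_expansion p q e ->
  has_expansion (a%:P * p + b%:P * q) (c%:P * p + d%:P * q)
    (fps_moebius a b c d e).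
Proof.
move=> cd0 [q0 qe].
have U : fpsC c * e + fpsC d \is a GRing.unit.
  by rewrite fps_unitE fcoef0_affine unitfE.
have E s t : fps_of_poly (s%:P * p + t%:P * q) =
    fps_of_poly q * (fpsC s * e + fpsC t).
  by rewrite fps_of_polyD !fps_of_polyM !fps_of_polyC -qe; ring.
split; last by rewrite !E -mulrA /fps_moebius [X in _ * X]mulrCA divrr // mulr1.
(* The new denominator is [q] times the unit [c e + d], so it vanishes only if [q] does. *)
apply: contra_neq q0 => D0; apply: fps_of_poly_eq0.
apply: (mulIr U); rewrite mul0r -E D0.
by apply/fpsP=> n /=; rewrite coef0.
Qed.

End Convergents.

(** A solution of a second-order recurrence is determined by its first two values, and solutions are
    closed under linear combination. *)
Lemma recurrence_combination (A : comNzRingType) (a b x y z : nat -> A)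
    (s t : A) :
    (forall n, x n.+2 = a n * x n.+1 + b n * x n) ->
    (forall n, y n.+2 = a n * y n.+1 + b n * y n) ->
    (forall n, z n.+2 = a n * z n.+1 + b n * z n) ->
    z 0%N = s * x 0%N + t * y 0%N -> z 1%N = s * x 1%N + t * y 1%N ->
  forall n, z n = s * x n + t * y n.
Proof.
move=> xS yS zS z0 z1 n.
suff [] : z n = s * x n + t * y n /\ z n.+1 = s * x n.+1 + t * y n.+1 by [].
by elim: n => // n [IH0 IH1]; split; rewrite // zS xS yS IH0 IH1; ring.
Qed.

Lemma has_cf_expansion_moebius (F : fieldType) (g h : nat -> F) (f : fps F)
    (a b c d : F) :
  has_cf_expansion f
    (fun n => if n is 0%N then 1 else (g n)%:P + (h n)%:P * 'X)
    (fun n => match n with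
              | 0%N => 0
              | 1%N => - ((h 1%N)%:P * 'X)
              | _ => - ((g n.-1 * h n)%:P * 'X)
              end) ->
  c + d != 0 ->
  has_cf_expansion (fps_moebius a b c d f)
    (fun n => match n with
              | 0%N => ((a + b) / (c + d))%:P
              | 1%N => ((c + d) * g 1%N)%:P + (d * h 1%N)%:P * 'X
              | _ => (g n)%:P + (h n)%:P * 'X
              end)
    (fun n => match n with
              | 0%N => 0
              | 1%N => - (((a * d - b * c) / (c + d) * h 1%N)%:P * 'X)
              | 2%N => - (((c + d) * g 1%N * h 2%N)%:P * 'X)
              | _ => - ((g n.-1 * h n)%:P * 'X)
              end).
Proof.
set A := (fun n => _); set B := (fun n => _) => f_cf cd0.
set A' := (fun n => _); set B' := (fun n => _).
set k := (c + d)^-1 in A' B' *.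
have kcd : (c%:P + d%:P) * k%:P = 1 :> {poly F}.
  by rewrite -polyCD -polyCM divff.
(* The new numerators are homogeneous of degree 1 in [k], the old ones of
   degree 0; [kcd] restores the homogeneity needed for [ring]. *)
have numS n : cf_num A' B' n.+1 =
    a%:P * cf_num A B n.+1 + b%:P * cf_den A B n.+1.
  (* Both fractions have the same coefficients from index 3 on, so the sequences start at index 1
     and the values at indices 1 and 2 remain to be checked. *)
  apply: (recurrence_combination _ (fun n => A n.+3) (fun n => B n.+3)
    (fun n => cf_num A B n.+1) (fun n => cf_den A B n.+1)
    (fun n => cf_num A' B' n.+1)) => {n} [//|//|//||];
  by rewrite -[RHS]mul1r -kcd /cf_num /cf_den /A /B /A' /B' /=; ring.
have denS n : cf_den A' B' n.+1 =
    c%:P * cf_num A B n.+1 + d%:P * cf_den A B n.+1.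
  apply: (recurrence_combination _ (fun n => A n.+3) (fun n => B n.+3)
    (fun n => cf_num A B n.+1) (fun n => cf_den A B n.+1)
    (fun n => cf_den A' B' n.+1)) => {n} [//|//|//||];
  by rewrite /cf_num /cf_den /A /B /A' /B' /=; ring.
(* Read off the convergent [1 / 1] of index 0; it makes [c + d] the constant term of [c f + d],
   hence a unit. *)
have f0 : fcoef f 0 = 1.
  have [e [_ /fpsP/(_ 0%N) e0] <- //] := f_cf 0%N.
  by move: e0; rewrite fcoef0M /= !coefC /= mul1r.
move=> n; have [e pqe eq_ef] := f_cf n.
exists (fps_moebius a b c d e); last first.
  by apply: fps_moebius_congr eq_ef; rewrite f0 mulr1 unitfE.
have e0 : c * fcoef e 0 + d != 0 by rewrite eq_ef // f0 mulr1.
have := has_expansion_moebius _ a b _ _ _ _ _ e0 pqe.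
(* At index 0 the combinations are [a + b] and [c + d]; scaling by [k] turns them into
   [(a + b) / (c + d)] and 1. *)
case: n {pqe eq_ef} => [|n]; last by rewrite -numS -denS.
have k0 : k != 0 by rewrite invr_eq0.
move=> /(has_expansion_scale _ _ _ _ _ k0); rewrite /cf_num /cf_den /=.
rewrite !mulr1 -!polyCD -!polyCM ![k * _]mulrC.
by rewrite divff.
Qed.

Theorem theorem7 (R : realType) (g h : nat -> R[i]) (f : fps R[i])
    (a b c d : R[i]) :
  (forall n, (1 <= n)%N -> g n != 0) ->
  has_cf_expansion f
    (fun n => if n is 0%N then 1 else (g n)%:P + (h n)%:P * 'X)
    (fun n => match n with
              | 0%N => 0
              | 1%N => - ((h 1%N)%:P * 'X)
              | _ => - ((g n.-1 * h n)%:P * 'X)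
              end) ->
  a * d - b * c != 0 ->
  c + d != 0 ->
  has_cf_expansion (fps_moebius a b c d f)
    (fun n => match n with
              | 0%N => ((a + b) / (c + d))%:P
              | 1%N => ((c + d) * g 1%N)%:P + (d * h 1%N)%:P * 'X
              | _ => (g n)%:P + (h n)%:P * 'X
              end)
    (fun n => match n with
              | 0%N => 0
              | 1%N => - (((a * d - b * c) / (c + d) * h 1%N)%:P * 'X)
              | 2%N => - (((c + d) * g 1%N * h 2%N)%:P * 'X)
              | _ => - ((g n.-1 * h n)%:P * 'X)
              end).
Proof. by move=> _ f_cf _ cd0; apply: has_cf_expansion_moebius. Qed.
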